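(* The inclusion $cs_0^{\lambda}\subset cs_0$ holds if and only if $S(x)\in cs_0$ for every sequence $x\in cs_0^{\lambda}$.
   Context: $\mathbb{N}=\{0,1,2,\dots\}$ and $w=\mathbb{C}^{\mathbb{N}}$ is the space of all complex sequences. $\lambda=(\lambda_k)_{k\in\mathbb{N}}$ is a fixed strictly increasing sequence of positive reals tending to infinity, with the convention $\lambda_{-1}=0$. For $x=(x_k)\in w$ put $\Lambda(x)=(\Lambda_n(x))_{n\in\mathbb{N}}$, $\Lambda_n(x)=\frac{1}{\lambda_n}\sum_{k=0}^{n}(\lambda_k-\lambda_{k-1})x_k$, and $S(x)=(S_n(x))_{n\in\mathbb{N}}$, where $S_0(x)=0$ and $S_n(x)=\frac{1}{\lambda_n}\sum_{k=1}^{n}\lambda_{k-1}(x_k-x_{k-1})$ for $n\geq 1$. $cs_0$ is the space of sequences $x\in w$ such that $\lim_{m\to\infty}\sum_{n=0}^m x_n=0$, and $cs_0^{\lambda}=\{x\in w:\Lambda(x)\in cs_0\}$. *)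

(* Defs.v *)
From Stdlib Require Import Reals.
From Coquelicot Require Import Coquelicot.

(* The sequence k |-> lam (k - 1), with the convention lam (-1) = 0. *)
Definition shift_lam (lam : nat -> R) (k : nat) : R :=
  match k with
  | O => 0%R
  | S j => lam j
  end.

Definition Lambda_mean (lam : nat -> R) (x : nat -> C) (n : nat) : C :=
  (/ RtoC (lam n) *
   sum_n (fun k => RtoC (lam k - shift_lam lam k)%R * x k) n)%C.

(* In the second case the index k ranges over 1, ..., n, so [pred k] is k - 1. *)
Definition S_mean (lam : nat -> R) (x : nat -> C) (n : nat) : C :=
  match n with
  | O => RtoC 0
  | S _ =>
      (/ RtoC (lam n) *
       sum_n_m (fun k => RtoC (lam (pred k)) * (x k - x (pred k))) 1 n)%C
  end.

Definition cs0 (x : nat -> C) : Prop :=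
  filterlim (fun m => sum_n x m) eventually (locally (RtoC 0)).

Definition cs0_lambda (lam : nat -> R) (x : nat -> C) : Prop :=
  cs0 (Lambda_mean lam x).

(* Main.v *)
(** Abel summation gives [x = Lambda x + S x] termwise, hence also for partial
    sums; as [Lambda x] lies in [cs0] for the sequences considered, [x] lies in
    [cs0] exactly when [S x] does. *)
Require Import Defs.
From Stdlib Require Import Reals.
From Coquelicot Require Import Coquelicot.

(** The splitting [x = Lambda x + S x] is exact for every sequence, and [cs0] is closed under sums
    and negation. So once [Lambda x] is in [cs0], membership of [x] and of [S x] can be exchanged by
    adding or subtracting [Lambda x]. *)

(** The two summands of index [k >= 1] add up to [lam k * x k - lam (k-1) * x (k-1)], so the total
    telescopes; the convention [lam (-1) = 0] supplies the initial term [lam 0 * x 0]. *)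
Lemma Abel_summation (lam : nat -> R) (x : nat -> C) (n : nat) :
  (sum_n (fun k => RtoC (lam k - shift_lam lam k)%R * x k) n +
   sum_n_m (fun k => RtoC (lam (pred k)) * (x k - x (pred k))) 1 n
   = RtoC (lam n) * x n)%C.
Proof.
  induction n as [|n IH].
  - rewrite sum_O, sum_n_m_zero by auto with arith.
    change (@zero C_AbelianMonoid) with (RtoC 0); simpl.
    rewrite RtoC_minus; ring.
  - rewrite sum_Sn, sum_n_Sm by auto with arith.
    change (@plus C_AbelianMonoid) with Cplus; simpl.
    rewrite RtoC_minus.
    match type of IH with (?a + ?b = _)%C =>
      transitivity ((a + b) + ((RtoC (lam (S n)) - RtoC (lam n)) * x (S n)
                    + RtoC (lam n) * (x (S n) - x n)))%C; [ring|] end.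
    rewrite IH; ring.
Qed.

Lemma Lambda_mean_plus_S_mean (lam : nat -> R) (x : nat -> C) (n : nat) :
  lam n <> 0%R -> (Lambda_mean lam x n + S_mean lam x n = x n)%C.
Proof.
  intros Hn.
  assert (HC : RtoC (lam n) <> RtoC 0) by (intros H; apply Hn, RtoC_inj, H).
  transitivity (/ RtoC (lam n) * (RtoC (lam n) * x n))%C; [|now field].
  rewrite <- Abel_summation, Cmult_plus_distr_l.
  unfold Lambda_mean; f_equal.
  (* At index 0, [S_mean] is 0 by definition, which agrees with the scaled empty sum. *)
  destruct n as [|n]; [|reflexivity].
  rewrite sum_n_m_zero by auto with arith.
  symmetry; apply Cmult_0_r.
Qed.

Lemma cs0_ext (x y : nat -> C) : (forall n, x n = y n) -> cs0 x -> cs0 y.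
Proof.
  intros E; apply filterlim_ext; intros m; now apply sum_n_ext.
Qed.

Lemma cs0_plus (x y : nat -> C) :
  cs0 x -> cs0 y -> cs0 (fun n => x n + y n)%C.
Proof.
  intros Hx Hy; unfold cs0.
  (* The limit is written [0 + 0] to use continuity of addition at [(0, 0)]. *)
  rewrite <- (Cplus_0_l (RtoC 0)).
  apply filterlim_ext with
    (fun m => @plus C_R_NormedModule (sum_n x m) (sum_n y m)).
  - intros m; symmetry; exact (sum_n_plus x y m).
  - exact (filterlim_comp_2 _ _ _ Hx Hy
             (@filterlim_plus _ C_R_NormedModule (RtoC 0) (RtoC 0))).
Qed.

Lemma cs0_opp (x : nat -> C) : cs0 x -> cs0 (fun n => - x n)%C.
Proof.
  intros Hx; unfold cs0.
  replace (RtoC 0) with (- RtoC 0)%C by ring.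
  apply filterlim_ext with
    (fun m => @opp C_R_NormedModule (sum_n x m)).
  - intros m; induction m as [|m IH].
    + now rewrite !sum_O.
    + rewrite !sum_Sn, <- IH; exact (Copp_plus_distr _ _).
  - exact (filterlim_comp _ _ _ _ _ _ _ _ Hx
             (@filterlim_opp _ C_R_NormedModule (RtoC 0))).
Qed.

Theorem theorem3p6 (lam : nat -> R)
  (lam_pos : forall k : nat, (0 < lam k)%R)
  (lam_incr : forall k : nat, (lam k < lam (S k))%R)
  (lam_lim : is_lim_seq lam p_infty) :
  (forall x : nat -> C, cs0_lambda lam x -> cs0 x) <->
  (forall x : nat -> C, cs0_lambda lam x -> cs0 (S_mean lam x)).
Proof.
  assert (E : forall x n, (Lambda_mean lam x n + S_mean lam x n = x n)%C)
    by (intros x n; apply Lambda_mean_plus_S_mean, Rgt_not_eq, lam_pos).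
  split; intros H x Hx.
  (* Here [S x = x - Lambda x], and the assumed inclusion puts [x] in [cs0]. *)
  - apply cs0_ext with (fun n => x n + - Lambda_mean lam x n)%C.
    + intros n; rewrite <- (E x n) at 1; ring.
    + apply cs0_plus; [now apply H | now apply cs0_opp].
  - apply cs0_ext with (fun n => Lambda_mean lam x n + S_mean lam x n)%C.
    + apply E.
    + apply cs0_plus; [exact Hx | now apply H].
Qed.
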